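(* Let $\mathbb{F}_q$ be a finite field of odd characteristic and let $\epsilon,\delta\in\mathbb{F}_q$ with $\epsilon(\delta^2-\epsilon)\neq 0$ and $\chi(\epsilon)=1$. Fix a square root $\sqrt{\epsilon}\in\mathbb{F}_q$ of $\epsilon$. Then the Jacobi quartic curve $J_{\epsilon,\delta}: y^2=\epsilon x^4+2\delta x^2+1$ over $\mathbb{F}_q$ has dADD-M formulas with the function $$w(x,y)=\sqrt{\epsilon}\,x^2$$ and $e=\dfrac{2(\sqrt{\epsilon}-\delta)}{\sqrt{\epsilon}}$; that is, $w$ is an inverted Montgomery-like function on $J_{\epsilon,\delta}$ with parameter $e$.
   Context: $\chi$ is the quadratic character of $\mathbb{F}_q$: for $a\ne0$, $\chi(a)=1$ if $a$ is a square in $\mathbb{F}_q$ and $\chi(a)=-1$ otherwise. The Jacobi quartic curve $J_{\epsilon,\delta}$ is regarded as an elliptic curve through its smooth projective model $X^2=TZ$, $Y^2=\epsilon T^2+2\delta X^2+Z^2$ in $\mathbb{P}^3$ with coordinates $(X:Y:T:Z)$, the affine point $(x,y)$ being $(x:y:x^2:1)$; the points with $Z=0$ are $(0:\pm\sqrt{\epsilon}:1:0)$. The identity is $(0,1)$, $-(x,y)=(-x,y)$, and addition is generically $$(x_1,y_1)+(x_2,y_2)=\left(\frac{x_1y_2+x_2y_1}{1-\epsilon x_1^2x_2^2},\ \frac{(y_1y_2+2\delta x_1x_2)(1+\epsilon x_1^2x_2^2)+2\epsilon x_1x_2(x_1^2+x_2^2)}{(1-\epsilon x_1^2x_2^2)^2}\right).$$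 Inverted Montgomery-like function: let $E$ be an elliptic curve over a field $\mathbb{F}$ of characteristic $\neq2$ and $w$ a rational function on $E$ with $w(P)=w(-P)$ for all $P$. View $w(P)$ in $\mathbb{P}^1(\mathbb{F})$ as $(w(P):1)$ if $w$ is regular at $P$ and $(1:0)$ otherwise. For $P_1,P_2\in E(\mathbb{F})$ put $(W_0:Z_0)=w(P_2-P_1)$, $(W_1:Z_1)=w(P_1)$, $(W_2:Z_2)=w(P_2)$, $(W_3:Z_3)=w(P_1+P_2)$, $(W_4:Z_4)=w(2P_1)$. Then $w$ is an inverted Montgomery-like function with parameter $e\in\mathbb{F}$ if for all $P_1,P_2\in E(\mathbb{F})$ with $W_0Z_0\neq0$, $$(W_4:Z_4)=\big(4W_1Z_1((W_1+Z_1)^2-eW_1Z_1):(W_1^2-Z_1^2)^2\big),$$ $$(W_3:Z_3)=\big(Z_0(W_1Z_2-W_2Z_1)^2:W_0(W_1W_2-Z_1Z_2)^2\big).$$ (Equivalently $1/w$ is a Montgomery-like function, given by the same formulas with the two coordinates swapped; a curve with such a function is said to have dADD-M formulas.) *)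

(* Defs.v *)
From mathcomp Require Import all_boot all_order all_algebra all_field.
From mathcomp Require Import mpoly.
From mathcomp Require Import boolp. (* pselect, cid: see P1_value *)
From mathcomp Require Import ring.

Set Implicit Arguments.
Unset Strict Implicit.
Unset Printing Implicit Defensive.

Import GRing.Theory.
Local Open Scope ring_scope.

(* The value at 0 is a convention; it plays no role for a nonzero argument. *)
Definition quad_char (F : finFieldType) (a : F) : int :=
  if a == 0 then 0 else if [exists b : F, b ^+ 2 == a] then 1 else -1.

(* A group law on a projective curve in P^(n-1).  A rational point is handled
   through its homogeneous coordinate vectors, i.e. nonzero 'rV[F]_n on which
   the equations vanish; negation is given by a tuple of forms, and gadd returns
   a coordinate vector of the sum. *)
Record group_curve (F : fieldType) (n : nat) := GroupCurve {
  neqs : nat;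
  equations : neqs.-tuple {mpoly F[n]};
  opp_forms : n.-tuple {mpoly F[n]};
  gadd : 'rV[F]_n -> 'rV[F]_n -> 'rV[F]_n
}.

Section GroupCurve.
Variables (F : fieldType) (n : nat) (E : group_curve F n).

Definition on_curve (P : 'rV[F]_n) : Prop :=
  P != 0 /\ forall i, (tnth (equations E) i).@[P ord0] = 0.

Definition gopp (P : 'rV[F]_n) : 'rV[F]_n :=
  \row_i (tnth (opp_forms E) i).@[P ord0].

Definition gsub (P Q : 'rV[F]_n) : 'rV[F]_n := gadd E P (gopp Q).

(* Membership in the ideal generated by the equations, which is to be the
   homogeneous ideal of the curve. *)
Definition vanishes_on_curve (h : {mpoly F[n]}) : Prop :=
  exists c : 'I_(neqs E) -> {mpoly F[n]},
    h = \sum_i c i * tnth (equations E) i.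

(* Rational functions on the curve are fractions w.1 / w.2 of forms of equal
   degree with w.2 nonzero on the curve, modulo eq_ratfun. *)
Definition is_ratfun (w : {mpoly F[n]} * {mpoly F[n]}) : Prop :=
  [/\ exists d : nat, (w.1 \is d.-homog) && (w.2 \is d.-homog)
    & ~ vanishes_on_curve w.2].

Definition eq_ratfun (v w : {mpoly F[n]} * {mpoly F[n]}) : Prop :=
  vanishes_on_curve (v.1 * w.2 - w.1 * v.2).

Definition regular_with_value (w : {mpoly F[n]} * {mpoly F[n]})
    (P : 'rV[F]_n) (c : F) : Prop :=
  exists v : {mpoly F[n]} * {mpoly F[n]},
    [/\ is_ratfun v, eq_ratfun v w, v.2.@[P ord0] != 0
      & c = v.1.@[P ord0] / v.2.@[P ord0]].

Definition P1_value (w : {mpoly F[n]} * {mpoly F[n]}) (P : 'rV[F]_n) : F * F :=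
  if pselect (exists c, regular_with_value w P c) is left h
  then (projT1 (cid h), 1) else (1, 0).

(* w(P) = w(-P) is an identity of rational functions: it concerns all geometric
   points P, not only the rational ones. *)
Definition even_ratfun (w : {mpoly F[n]} * {mpoly F[n]}) : Prop :=
  eq_ratfun (w.1 \mPo opp_forms E, w.2 \mPo opp_forms E) w.

Definition P1_eq (p q : F * F) : Prop :=
  exists2 c : F, c != 0 & p = (c * q.1, c * q.2).

Definition inverted_montgomery_like (w : {mpoly F[n]} * {mpoly F[n]})
    (e : F) : Prop :=
  [/\ is_ratfun w, even_ratfun w
    & forall P1 P2 : 'rV[F]_n, on_curve P1 -> on_curve P2 ->
      let: (W0, Z0) := P1_value w (gsub P2 P1) in
      let: (W1, Z1) := P1_value w P1 in
      let: (W2, Z2) := P1_value w P2 in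
      let: (W3, Z3) := P1_value w (gadd E P1 P2) in
      let: (W4, Z4) := P1_value w (gadd E P1 P1) in
      W0 * Z0 != 0 ->
      P1_eq (W4, Z4)
            (4 * W1 * Z1 * ((W1 + Z1) ^+ 2 - e * W1 * Z1),
             (W1 ^+ 2 - Z1 ^+ 2) ^+ 2) /\
      P1_eq (W3, Z3)
            (Z0 * (W1 * Z2 - W2 * Z1) ^+ 2,
             W0 * (W1 * W2 - Z1 * Z2) ^+ 2)].

End GroupCurve.

Section JacobiQuartic.
Variables (F : fieldType) (eps delta : F).

Definition row4 (X Y T Z : F) : 'rV[F]_4 := \row_i [:: X; Y; T; Z]`_i.

(* Coordinates 0, 1, 2, 3 are X, Y, T, Z. *)
Definition jq_equations : 2.-tuple {mpoly F[4]} :=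
  let X : {mpoly F[4]} := 'X_0 in let Y : {mpoly F[4]} := 'X_1 in
  let T : {mpoly F[4]} := 'X_2 in let Z : {mpoly F[4]} := 'X_3 in
  [tuple X ^+ 2 - T * Z;
         Y ^+ 2 - (eps *: T ^+ 2 + (2 * delta) *: X ^+ 2 + Z ^+ 2)].

Definition jq_opp : 4.-tuple {mpoly F[4]} := [tuple - 'X_0; 'X_1; 'X_2; 'X_3].

(* The generic affine addition formula with denominators cleared, in the
   coordinates (x : y : x^2 : 1). *)
Definition jq_law (P Q : 'rV[F]_4) : 'rV[F]_4 :=
  let X1 := P 0 0 in let Y1 := P 0 1 in let T1 := P 0 2 in let Z1 := P 0 3 in
  let X2 := Q 0 0 in let Y2 := Q 0 1 in let T2 := Q 0 2 in let Z2 := Q 0 3 in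
  row4 ((X1 * Y2 + X2 * Y1) * (Z1 * Z2 - eps * T1 * T2))
       ((Y1 * Y2 + 2 * delta * X1 * X2) * (Z1 * Z2 + eps * T1 * T2)
          + 2 * eps * X1 * X2 * (T1 * Z2 + T2 * Z1))
       ((X1 * Y2 + X2 * Y1) ^+ 2)
       ((Z1 * Z2 - eps * T1 * T2) ^+ 2).

(* Another expression of the same map, used where jq_law gives 0 : 0 : 0 : 0:
     x3 = (x1^2 - x2^2) / (x1 y2 - x2 y1),
     y3 = ((x1^2 + x2^2) (y1 y2 - 2 delta x1 x2)
             - 2 x1 x2 (1 + eps x1^2 x2^2)) / (x1 y2 - x2 y1)^2.
   jq_laws_agree and jq_laws_complete show that the two expressions glue to a
   morphism defined on all pairs of points, so this is the group law. *)
Definition jq_law' (P Q : 'rV[F]_4) : 'rV[F]_4 :=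
  let X1 := P 0 0 in let Y1 := P 0 1 in let T1 := P 0 2 in let Z1 := P 0 3 in
  let X2 := Q 0 0 in let Y2 := Q 0 1 in let T2 := Q 0 2 in let Z2 := Q 0 3 in
  row4 ((T1 * Z2 - T2 * Z1) * (X1 * Y2 - X2 * Y1))
       ((T1 * Z2 + T2 * Z1) * (Y1 * Y2 - 2 * delta * X1 * X2)
          - 2 * X1 * X2 * (Z1 * Z2 + eps * T1 * T2))
       ((T1 * Z2 - T2 * Z1) ^+ 2)
       ((X1 * Y2 - X2 * Y1) ^+ 2).

Definition jq_add (P Q : 'rV[F]_4) : 'rV[F]_4 :=
  if jq_law P Q != 0 then jq_law P Q else jq_law' P Q.

Definition jacobi_quartic : group_curve F 4 :=
  GroupCurve jq_equations jq_opp jq_add.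

(* s x^2 with x = X / Z *)
Definition jq_w (s : F) : {mpoly F[4]} * {mpoly F[4]} :=
  (s *: 'X_0 ^+ 2, 'X_3 ^+ 2).

Definition affine_point (x y : F) : 'rV[F]_4 := row4 x y (x ^+ 2) 1.

Lemma row4_eq0 X Y T Z :
  (row4 X Y T Z == 0) = [&& X == 0, Y == 0, T == 0 & Z == 0].
Proof.
apply/eqP/and4P => [/rowP h | [/eqP-> /eqP-> /eqP-> /eqP->]].
  by split; apply/eqP; [move: (h 0)|move: (h 1)|move: (h 2)|move: (h 3)];
    rewrite !mxE.
by apply/rowP => -[[|[|[|[|]]]] ?] //; rewrite !mxE.
Qed.

Lemma row4_eta (P : 'rV[F]_4) : P = row4 (P 0 0) (P 0 1) (P 0 2) (P 0 3).
Proof.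
by apply/rowP => -[[|[|[|[|]]]] ?] //; rewrite !mxE /=; congr (P _ _);
   apply: val_inj.
Qed.

Lemma on_jacobi_quarticP X Y T Z :
  on_curve jacobi_quartic (row4 X Y T Z) <->
  [/\ ~~ [&& X == 0, Y == 0, T == 0 & Z == 0], X ^+ 2 = T * Z
    & Y ^+ 2 = eps * T ^+ 2 + 2 * delta * X ^+ 2 + Z ^+ 2].
Proof.
have ev0 : (tnth jq_equations 0).@[row4 X Y T Z ord0] = X ^+ 2 - T * Z.
  by rewrite (tnth_nth 0) /= mevalB rmorphXn mevalM /= !mevalXU !mxE.
have ev1 : (tnth jq_equations 1).@[row4 X Y T Z ord0]
    = Y ^+ 2 - (eps * T ^+ 2 + 2 * delta * X ^+ 2 + Z ^+ 2).
  by rewrite (tnth_nth 0) /= mevalB rmorphXn !mevalD !mevalZ !rmorphXn /= !mevalXU !mxE.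
rewrite /on_curve row4_eq0; split=> [[-> h] | [-> hX hY]]; split=> //.
- by apply/eqP; rewrite -subr_eq0 -ev0 (h 0).
- by apply/eqP; rewrite -subr_eq0 -ev1 (h 1).
move=> -[[|[|]] hi] //=.
- by rewrite (_ : Ordinal hi = 0) ?ev0 ?hX ?subrr//; apply: val_inj.
- by rewrite (_ : Ordinal hi = 1) ?ev1 ?hY ?subrr//; apply: val_inj.
Qed.

Lemma jq_laws_agree (P Q : 'rV[F]_4) i j :
  on_curve jacobi_quartic P -> on_curve jacobi_quartic Q ->
  jq_law P Q 0 i * jq_law' P Q 0 j = jq_law P Q 0 j * jq_law' P Q 0 i.
Proof.
rewrite (row4_eta P) (row4_eta Q).
move: (P 0 0) (P 0 1) (P 0 2) (P 0 3) => X1 Y1 T1 Z1.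
move: (Q 0 0) (Q 0 1) (Q 0 2) (Q 0 3) => X2 Y2 T2 Z2.
move=> /on_jacobi_quarticP[_ hX1 hY1] /on_jacobi_quarticP[_ hX2 hY2].
rewrite hX1 in hY1; rewrite hX2 in hY2.
wlog lt_ij : i j / (i < j)%N => [th|].
  by case: (ltngtP i j) => [/th | /th/esym | /val_inj ->].
rewrite /jq_law /jq_law' !mxE /=.
case: i lt_ij => -[|[|[|[|i]]]] hi //; case: j => -[|[|[|[|j]]]] hj //= _;
  ring: hX1 hY1 hX2 hY2.
Qed.

Lemma jq_laws_complete (P Q : 'rV[F]_4) :
  2 != 0 :> F -> eps * (delta ^+ 2 - eps) != 0 ->
  on_curve jacobi_quartic P -> on_curve jacobi_quartic Q ->
  (jq_law P Q != 0) || (jq_law' P Q != 0).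
Proof.
move=> two_neq0; rewrite mulf_eq0 negb_or subr_eq0 => /andP[eps_neq0 ns].
rewrite (row4_eta P) (row4_eta Q).
move: (P 0 0) (P 0 1) (P 0 2) (P 0 3) => X1 Y1 T1 Z1.
move: (Q 0 0) (Q 0 1) (Q 0 2) (Q 0 3) => X2 Y2 T2 Z2.
move=> /on_jacobi_quarticP[n1 hX1 hY1] /on_jacobi_quarticP[n2 hX2 hY2].
have nz X Y T Z : ~~ [&& X == 0, Y == 0, T == 0 & Z == 0] ->
    X ^+ 2 = T * Z -> Y ^+ 2 = eps * T ^+ 2 + 2 * delta * X ^+ 2 + Z ^+ 2 ->
    X = 0 -> Y != 0.
  move=> n0 hX hY X0; apply: contra n0 => /eqP Y0; move: hX hY.
  rewrite {}X0 {}Y0 !expr0n /= mulr0 addr0 eqxx /= => hTZ hS.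
  have /eqP := esym hTZ; rewrite mulf_eq0 => /orP[] /eqP h0; move: hS;
    rewrite h0 expr0n /= ?mulr0 ?add0r ?addr0 eqxx ?andbT => /esym/eqP.
    by rewrite expf_eq0.
  by rewrite mulf_eq0 expf_eq0 (negPf eps_neq0).
rewrite -negb_and /jq_law /jq_law' !mxE /= !row4_eq0.
apply/negP => /andP[/and4P[_ _ A B] /and4P[_ _ C D]].
move: A B C D; rewrite !expf_eq0 /= addr_eq0 !subr_eq0 => /eqP A /eqP B /eqP C.
move=> /eqP D.
have XY1 : X1 * Y2 = 0.
  have : 2 * (X1 * Y2) = 0 by rewrite mulr_natl mulr2n {2}D A addNr.
  by move/eqP; rewrite mulf_eq0 (negPf two_neq0) => /eqP.
have XY2 : X2 * Y1 = 0 by rewrite -D.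
have [Y10|Y1n] := eqVneq Y1 0.
  have X1n : X1 != 0 by apply/eqP => /(nz _ _ _ _ n1 hX1 hY1)/eqP.
  have Y20 : Y2 = 0.
    by move/eqP: XY1; rewrite mulf_eq0 (negPf X1n) => /eqP.
  have X2n : X2 != 0 by apply/eqP => /(nz _ _ _ _ n2 hX2 hY2)/eqP.
  have TZ1 : T1 * Z1 != 0 by rewrite -hX1 expf_neq0.
  have TZ2 : T2 * Z2 != 0 by rewrite -hX2 expf_neq0.
  move: TZ1 TZ2; rewrite !mulf_eq0 !negb_or => /andP[T1n Z1n] /andP[T2n Z2n].
  have sq : Z1 ^+ 2 = eps * T1 ^+ 2.
    apply: (mulIf T2n); transitivity (T1 * (Z1 * Z2)); last by rewrite B; ring.
    by rewrite mulrCA C; ring.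
  have dl : delta * T1 = - Z1.
    apply/eqP; rewrite -addr_eq0; apply/eqP.
    have /eqP : 2 * (T1 * Z1) * Z1 * (delta * T1 + Z1) = 0.
      transitivity (Z1 * T1 * (eps * T1 ^+ 2 + 2 * delta * X1 ^+ 2 + Z1 ^+ 2)).
        by rewrite hX1 -sq; ring.
      by rewrite -hY1 Y10 expr0n mulr0.
    by rewrite !mulf_eq0 (negPf two_neq0) (negPf T1n) (negPf Z1n) => /eqP.
  have T12 : T1 ^+ 2 != 0 by rewrite expf_neq0.
  case/eqP: ns; apply: (mulIf T12).
  by rewrite -exprMn dl sqrrN sq.
have X20 : X2 = 0 by move/eqP: XY2; rewrite mulf_eq0 (negPf Y1n) orbF => /eqP.
have Y2n := nz _ _ _ _ n2 hX2 hY2 X20.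
have X10 : X1 = 0 by move/eqP: XY1; rewrite mulf_eq0 (negPf Y2n) orbF => /eqP.
move: hX1 hX2 hY1 hY2; rewrite X10 X20 !expr0n /= !mulr0 !addr0.
move=> TZ1 TZ2 hY1 hY2.
have [T10|T1n] := eqVneq T1 0.
  have Z1n : Z1 != 0.
    apply: contraNneq Y1n => Z10.
    by rewrite -sqrf_eq0 hY1 T10 Z10 !expr0n mulr0 addr0.
  move: B C; rewrite T10 mulr0 !mul0r => /eqP; rewrite mulf_eq0 (negPf Z1n) /=.
  move=> /eqP Z20 /esym/eqP; rewrite mulf_eq0 (negPf Z1n) orbF => /eqP T20.
  by move: Y2n; rewrite -sqrf_eq0 hY2 T20 Z20 !expr0n mulr0 addr0 eqxx.
have Z10 : Z1 = 0 by move/esym/eqP: TZ1; rewrite mulf_eq0 (negPf T1n) => /eqP.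
move: B C; rewrite Z10 mul0r mulr0 => /esym/eqP.
rewrite !mulf_eq0 (negPf eps_neq0) (negPf T1n) /= => /eqP T20 /eqP.
rewrite mulf_eq0 (negPf T1n) /= => /eqP Z20.
by move: Y2n; rewrite -sqrf_eq0 hY2 T20 Z20 !expr0n mulr0 addr0 eqxx.
Qed.

Lemma jq_add_on_curve (P Q : 'rV[F]_4) :
  2 != 0 :> F -> eps * (delta ^+ 2 - eps) != 0 ->
  on_curve jacobi_quartic P -> on_curve jacobi_quartic Q ->
  on_curve jacobi_quartic (jq_add P Q).
Proof.
move=> two_neq0 ns hP hQ; have := jq_laws_complete two_neq0 ns hP hQ.
rewrite /jq_add; case: ifPn => [n _|_ /= n]; move: hP hQ n;
  rewrite (row4_eta P) (row4_eta Q);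
  move: (P 0 0) (P 0 1) (P 0 2) (P 0 3) => X1 Y1 T1 Z1;
  move: (Q 0 0) (Q 0 1) (Q 0 2) (Q 0 3) => X2 Y2 T2 Z2;
  move=> /on_jacobi_quarticP[_ hX1 hY1] /on_jacobi_quarticP[_ hX2 hY2];
  rewrite hX1 in hY1; rewrite hX2 in hY2;
  rewrite /jq_law /jq_law' !mxE /= row4_eq0 => n;
  apply/on_jacobi_quarticP; split=> //; by [ring: hX1 hY1 hX2 hY2].
Qed.

Lemma jq_add_affine (x1 y1 x2 y2 d : F) :
  d = 1 - eps * x1 ^+ 2 * x2 ^+ 2 -> d != 0 ->
  jq_add (affine_point x1 y1) (affine_point x2 y2) =
  d ^+ 2 *: affine_point
    ((x1 * y2 + x2 * y1) / d)
    (((y1 * y2 + 2 * delta * x1 * x2) * (1 + eps * x1 ^+ 2 * x2 ^+ 2)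
      + 2 * eps * x1 * x2 * (x1 ^+ 2 + x2 ^+ 2)) / d ^+ 2).
Proof.
move=> dE dn.
have {}dE : 1 * 1 - eps * x1 ^+ 2 * x2 ^+ 2 = d by rewrite dE mulr1.
rewrite /jq_add ifT; last first.
  by rewrite /jq_law !mxE /= row4_eq0 dE !expf_eq0 /= (negPf dn) !andbF.
by apply/rowP => -[[|[|[|[|i]]]] hi] //; rewrite !mxE /= ?dE; field.
Qed.

End JacobiQuartic.

(* Main.v *)
Require Import Defs.
From mathcomp Require Import all_boot all_order all_algebra all_field.
From mathcomp Require Import mpoly.
From mathcomp Require Import boolp ring.
Import GRing.Theory.
Local Open Scope ring_scope.

(** On the smooth model X^2 = TZ, so w = s X^2/Z^2 is the ratio (sT : Z) at
    every rational point, with value (1 : 0) exactly at the points where Z = 0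
    ([jq_w_value]).  Both Montgomery identities then become identities between
    the T and Z coordinates given by the addition law.

    Write s^2 = eps, and for points P and Q with coordinates X1, ..., Z1 and
    X2, ..., Z2 put
      A = X1 Y2 + X2 Y1,  B = X2 Y1 - X1 Y2,
      C = Z1 Z2 - eps T1 T2,  D = T2 Z1 - T1 Z2.
    The two expressions of the addition law give for P + Q the ratio (T : Z) as
    (A^2 : C^2) or (D^2 : B^2), and changing the sign of X1 exchanges A and B,
    so that for Q - P they give (B^2 : C^2) or (D^2 : A^2).  The
    curve equations give A B = C D, and hence
      (s T : Z)(P + Q) = (s Z0 D^2 : T0 C^2),  (T0 : Z0) = (T : Z)(Q - P),
    which is the differential addition formula, as C and D are, up to sign and
    a power of s, the two differences that occur in it ([jq_w_add]).  For
    P = Q, B and D vanish, so the sum has (T : Z) = (A^2 : C^2) with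
    A^2 = 4 X1^2 Y1^2 a quartic form in T1 and Z1 ([jq_w_double]).

    The one point that is not such an identity is that w really has a pole
    where Z = 0, that is, that no other representative of the same function is
    defined there.  This is seen by following the curve to second order through
    the point ([jq_w_pole]). *)

Section RationalFunctions.
Variables (F : fieldType) (n : nat) (E : group_curve F n).

Lemma vanishes_on_curve_meval (h : {mpoly F[n]}) (P : 'rV[F]_n) :
  vanishes_on_curve E h -> on_curve E P -> h.@[P ord0] = 0.
Proof.
move=> [c ->] [_ eqP0]; rewrite rmorph_sum big1 // => i _ /=.
by rewrite mevalM eqP0 mulr0.
Qed.

(** The difference of cross products of two representatives lies in the ideal
    of the curve, so it vanishes at P and the two quotients agree there. *)
Lemma regular_value_unique (w : {mpoly F[n]} * {mpoly F[n]}) P c :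
  on_curve E P -> w.2.@[P ord0] != 0 ->
  regular_with_value E w P c -> c = w.1.@[P ord0] / w.2.@[P ord0].
Proof.
move=> hP w2n [v [_ vw v2n ->]].
have /eqP := vanishes_on_curve_meval _ _ vw hP.
by rewrite mevalB !mevalM subr_eq0 -eqr_div // => /eqP.
Qed.

Lemma P1_value_regular (w : {mpoly F[n]} * {mpoly F[n]}) P :
  is_ratfun E w -> on_curve E P -> w.2.@[P ord0] != 0 ->
  P1_value E w P = (w.1.@[P ord0] / w.2.@[P ord0], 1).
Proof.
move=> wrat hP w2n; rewrite /P1_value.
case: pselect => [h | []]; last first.
  exists (w.1.@[P ord0] / w.2.@[P ord0]), w; split=> //.
  by exists (fun=> 0); rewrite subrr big1 // => i _; rewrite mul0r.
by rewrite (regular_value_unique _ _ _ hP w2n (projT2 (cid h))).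
Qed.

Lemma P1_value_pole (w : {mpoly F[n]} * {mpoly F[n]}) P :
  (forall c, ~ regular_with_value E w P c) -> P1_value E w P = (1, 0).
Proof.
move=> pole; rewrite /P1_value; case: pselect => // h.
by case: (pole _ (projT2 (cid h))).
Qed.

End RationalFunctions.

(** Substituting the polynomial arc [h] and then specializing its parameter is
    evaluation at the specialized point. *)
Lemma horner_mmap_polyC (F : fieldType) n (h : 'I_n -> {poly F})
    (p : {mpoly F[n]}) x :
  (mmap (@polyC F) h p).[x] = p.@[fun i => (h i).[x]].
Proof.
rewrite /meval /mmap horner_sum; apply: eq_bigr => m _.
rewrite hornerM hornerC /mmap1 horner_prod; congr (_ * _).
by apply: eq_bigr => i _; rewrite horner_exp.
Qed.

Section JacobiQuarticW.
Variables (F : fieldType) (eps delta s : F).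
Hypotheses (two_neq0 : 2 != 0 :> F) (sqrt_eps : s ^+ 2 = eps).
Hypothesis nonsingular : eps * (delta ^+ 2 - eps) != 0.

Let J := jacobi_quartic eps delta.

Let s_neq0 : s != 0.
Proof.
by apply: contraNneq nonsingular => s0; rewrite -sqrt_eps s0 expr0n mul0r.
Qed.

Lemma on_curve_Z0 (P : 'rV[F]_4) : on_curve J P ->
  P 0 3 = 0 -> [/\ P 0 0 = 0, P 0 2 != 0 & P 0 1 ^+ 2 = (s * P 0 2) ^+ 2].
Proof.
rewrite {1}(row4_eta P) => /on_jacobi_quarticP[n0 hX hY] Z0.
have X0 : P 0 0 = 0 by apply/eqP; rewrite -sqrf_eq0 hX Z0 mulr0.
have Y0 : P 0 1 ^+ 2 = (s * P 0 2) ^+ 2.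
  by rewrite hY X0 Z0 exprMn sqrt_eps; ring.
split=> //; apply: contraNneq n0 => T0.
rewrite X0 T0 Z0 !eqxx !andbT /=.
by rewrite -sqrf_eq0 Y0 T0 mulr0 expr0n.
Qed.

Lemma jq_w_ratfun : is_ratfun J (jq_w s).
Proof.
split.
  exists 2%N; rewrite /= dhomogZ.
    by rewrite -[2%N in X in X.-homog]mul1n dhomogMn // dhomogX /= mdeg1.
  by rewrite -[2%N in X in X.-homog]mul1n dhomogMn // dhomogX /= mdeg1.
(* The identity (0, 1) of the group is a point where Z^2 does not vanish. *)
have hP : on_curve J (row4 0 1 0 1).
  by apply/on_jacobi_quarticP; split; [rewrite oner_eq0 andbF | ring | ring].
move=> /vanishes_on_curve_meval/(_ hP)/eqP.
by rewrite /= rmorphXn /= mevalXU !mxE /= expr1n oner_eq0.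
Qed.

Lemma jq_w_even : even_ratfun J (jq_w s).
Proof.
exists (fun=> 0); rewrite big1 => [|i _]; last by rewrite mul0r.
rewrite /= comp_mpolyZ !rmorphXn /= !comp_mpolyXU /= sqrrN.
exact: subrr.
Qed.

(** Let v.1 / v.2 represent w with v.2(P) nonzero, so that
    v.1 Z^2 - s X^2 v.2 = k0 (X^2 - TZ) + k1 (Y^2 - ...).  Substitute the arc
    t |-> (T t : Y + a t^2 : T : T t^2) through P = (0 : Y : T : 0), where
    a = delta T^2 / Y is chosen so that the second equation vanishes to order
    four in t, while the first vanishes identically.  As Z^2 also has order
    four, s T^2 t^2 v.2 is divisible by t^4, which forces v.2(P) = 0. *)
Lemma jq_w_pole (P : 'rV[F]_4) c :
  on_curve J P -> P 0 3 = 0 -> ~ regular_with_value J (jq_w s) P c.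
Proof.
move=> hP Z0 [v [_ [k hk] v2n _]].
have [X0 Tn hY] := on_curve_Z0 P hP Z0.
have Yn : P 0 1 != 0 by rewrite -sqrf_eq0 hY sqrf_eq0 mulf_neq0.
pose a := delta * P 0 2 ^+ 2 / P 0 1.
pose arc (i : 'I_4) : {poly F} :=
  [:: (P 0 2)%:P * 'X; (P 0 1)%:P + a%:P * 'X^2; (P 0 2)%:P;
      (P 0 2)%:P * 'X^2]`_i.
have arc0 : (fun i => (arc i).[0]) =1 P ord0.
  by rewrite /arc [in X in _ =1 X](row4_eta P) => -[[|[|[|[|i]]]] hi] //;
    rewrite !mxE /= !hornerE ?X0 ?Z0 /= ?expr0n /= ?mulr0 ?addr0.
have [phi phiE] : exists phi : {rmorphism {mpoly F[4]} -> {poly F}},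
    forall p, phi p = mmap (@polyC F) arc p.
  by exists (mmap (@polyC F) arc : {rmorphism {mpoly F[4]} -> {poly F}}).
have phiX i : phi 'X_i = arc i by rewrite phiE mmapX mmap1U.
have phiZ b p : phi (b *: p) = b%:P * phi p by rewrite !phiE mmapZ.
have hYC : (P 0 1)%:P ^+ 2 = eps%:P * (P 0 2)%:P ^+ 2.
  by rewrite -!rmorphXn -rmorphM hY exprMn sqrt_eps.
have haC : a%:P * (P 0 1)%:P = delta%:P * (P 0 2)%:P ^+ 2.
  by rewrite -!rmorphXn -!rmorphM /a divfK.
have on_arc : s%:P * (P 0 2)%:P ^+ 2 * phi v.2 =
    'X^2 * (phi v.1 * (P 0 2)%:P ^+ 2
            - phi (k (lift ord0 ord0)) * (a%:P ^+ 2 - (P 0 2)%:P ^+ 2)).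
  apply: (mulfI (expf_neq0 2 (negbT (polyX_eq0 F)))).
  have := congr1 phi hk.
  rewrite !big_ord_recl big_ord0 addr0 !(tnth_nth 0) => {}hk.
  rewrite !(rmorphB, rmorphD, rmorphM, rmorphXn, phiZ, phiX) in hk.
  rewrite rmorph1 /arc /= in hk.
  (* [ring] needs a single monomial on the left of each hypothesis. *)
  move/eqP: hk; rewrite subr_eq addrC -subr_eq => /eqP/esym hk.
  by ring: hk hYC haC.
have /eqP := congr1 (horner^~ 0) on_arc.
rewrite !hornerE expr0n mul0r phiE horner_mmap_polyC (meval_eq _ arc0).
by rewrite !mulf_eq0 (negPf s_neq0) (negPf Tn) (negPf v2n).
Qed.

(** The factor [c] absorbs the normalization of the value to (w : 1) or
    (1 : 0), so that regular points and poles are treated alike below. *)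
Lemma jq_w_value (P : 'rV[F]_4) : on_curve J P ->
  exists2 c, c != 0 &
    P1_value J (jq_w s) P = (c * (s * P 0 2), c * P 0 3).
Proof.
move=> hP; have [Z0|Zn] := eqVneq (P 0 3) 0.
  have [_ Tn _] := on_curve_Z0 P hP Z0.
  exists (s * P 0 2)^-1; first by rewrite invr_eq0 mulf_neq0.
  rewrite P1_value_pole => [|c]; last exact: jq_w_pole.
  by rewrite Z0 mulr0 mulVf ?mulf_neq0.
exists (P 0 3)^-1; first by rewrite invr_eq0.
rewrite P1_value_regular //; [|exact: jq_w_ratfun|]; last first.
  by rewrite /= rmorphXn /= mevalXU expf_neq0.
move: hP; rewrite {1}(row4_eta P) => /on_jacobi_quarticP[_ hX _].
rewrite /= mevalZ !rmorphXn /= !mevalXU hX.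
by congr pair; field.
Qed.

Lemma jq_oppE (P : 'rV[F]_4) :
  gopp J P = row4 (- P 0 0) (P 0 1) (P 0 2) (P 0 3).
Proof.
apply/rowP => -[[|[|[|[|i]]]] hi] //; rewrite !mxE (tnth_nth 0) /=
  ?mevalN mevalXU //.
Qed.

Lemma jq_opp_on_curve (P : 'rV[F]_4) : on_curve J P -> on_curve J (gopp J P).
Proof.
rewrite jq_oppE {1}(row4_eta P) => /on_jacobi_quarticP[n0 hX hY].
by apply/on_jacobi_quarticP; rewrite oppr_eq0 sqrrN.
Qed.

(** For P + P the second expression of the addition law has T = Z = 0, which
    no point of the curve satisfies, so it is never the one in use. *)
Lemma jq_double (P : 'rV[F]_4) : on_curve J P ->
  jq_add eps delta P P = jq_law eps delta P P.
Proof.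
move=> hP; have := jq_add_on_curve two_neq0 nonsingular hP hP.
rewrite /jq_add; case: ifP => // _ /on_curve_Z0; rewrite !mxE /=.
rewrite mulrC subrr expr0n => /(_ erefl)[_].
by rewrite [_ * P 0 3]mulrC subrr expr0n eqxx.
Qed.

(** Here s T = 4 s X^2 Y^2, and the curve equations turn it into
    4 W Z (W^2 + 2 (delta / s) W Z + Z^2), whose last factor is
    (W + Z)^2 - e W Z for the parameter e = 2 (s - delta) / s. *)
Lemma jq_w_double (P : 'rV[F]_4) : on_curve J P ->
  let S := jq_add eps delta P P in
  let W := s * P 0 2 in let Z := P 0 3 in
  s * S 0 2 = 4 * W * Z * ((W + Z) ^+ 2 - 2 * (s - delta) / s * W * Z)
  /\ S 0 3 = (W ^+ 2 - Z ^+ 2) ^+ 2.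
Proof.
move=> hP /=; rewrite jq_double // !mxE /=; move: hP.
rewrite {1}(row4_eta P) => /on_jacobi_quarticP[_ hX hY].
split; last by rewrite -sqrt_eps; ring.
transitivity (4 * s * (P 0 0 ^+ 2) * (P 0 1 ^+ 2)); first by ring.
by rewrite hY hX -sqrt_eps; field.
Qed.

(** The cases are the expressions in use for Q - P and P + Q.  If the first one
    serves both, the relation A B = C D converts (A^2 : C^2) into
    (D^2 : B^2).  The second one serves Q - P only when B = C = 0; then both
    sides are (1 : 0). *)
Lemma jq_w_add (P Q : 'rV[F]_4) : on_curve J P -> on_curve J Q ->
  let R := gsub J Q P in let S := jq_add eps delta P Q in
  R 0 2 * R 0 3 != 0 ->
  exists2 c, c != 0 &
    s * S 0 2 = c * (R 0 3 * (s * P 0 2 * Q 0 3 - s * Q 0 2 * P 0 3) ^+ 2)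
    /\ S 0 3 =
      c * (s * R 0 2 * (s * P 0 2 * (s * Q 0 2) - P 0 3 * Q 0 3) ^+ 2).
Proof.
rewrite /gsub jq_oppE (row4_eta P) (row4_eta Q).
move: (P 0 0) (P 0 1) (P 0 2) (P 0 3) => X1 Y1 T1 Z1.
move: (Q 0 0) (Q 0 1) (Q 0 2) (Q 0 3) => X2 Y2 T2 Z2.
move=> /on_jacobi_quarticP[_ hX1 hY1] /on_jacobi_quarticP[_ hX2 hY2].
pose A := X1 * Y2 + X2 * Y1; pose B := X2 * Y1 - X1 * Y2.
pose C := Z1 * Z2 - eps * T1 * T2; pose D := T2 * Z1 - T1 * Z2.
have AB_CD : A * B = C * D.
  transitivity (X2 ^+ 2 * Y1 ^+ 2 - X1 ^+ 2 * Y2 ^+ 2).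
    by rewrite /A /B; ring.
  by rewrite hY1 hY2 hX1 hX2 /C /D; ring.
rewrite !mxE /=.
have -> : (s * T1 * Z2 - s * T2 * Z1) ^+ 2 = s ^+ 2 * D ^+ 2.
  by rewrite /D; ring.
have -> : (s * T1 * (s * T2) - Z1 * Z2) ^+ 2 = C ^+ 2.
  by rewrite /C -sqrt_eps; ring.
set S := jq_add _ _ (row4 X1 _ _ _) _; set R := jq_add _ _ (row4 X2 _ _ _) _.
have hS : S 0 2 = A ^+ 2 /\ S 0 3 = C ^+ 2 \/
    S 0 2 = D ^+ 2 /\ S 0 3 = B ^+ 2.
  by rewrite /S /jq_add; case: ifP => _; [left | right];
    rewrite !mxE /= /A /B /C /D; split; ring.
have hR : R 0 2 = B ^+ 2 /\ R 0 3 = C ^+ 2 \/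
    [/\ R 0 2 = D ^+ 2, R 0 3 = A ^+ 2, B = 0 & C = 0].
  rewrite /R /jq_add; case: ifP => [_|/negbFE h]; [left | right].
    by rewrite !mxE /= /B /C; split; ring.
  move: h; rewrite /jq_law row4_eq0 !mxE /= => /and4P[_ _].
  rewrite !sqrf_eq0 => /eqP hB /eqP hC.
  by split; [| | rewrite -hB | rewrite -hC]; rewrite /A /B /C /D; ring.
clearbody A B C D S R.
case: hR => [[-> ->] | [-> -> B0 C0]]; rewrite mulf_eq0 !sqrf_eq0 negb_or.
  move=> /andP[Bn Cn]; case: hS => [[-> ->] | [-> ->]].
    exists (s * B ^+ 2)^-1; first by rewrite invr_eq0 mulf_neq0 ?sqrf_eq0.
    split; last by field; rewrite s_neq0 Bn.
    have -> : A = C * D / B by rewrite -AB_CD mulfK.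
    by field; rewrite s_neq0 Bn.
  exists (s * C ^+ 2)^-1; first by rewrite invr_eq0 mulf_neq0 ?sqrf_eq0.
  by split; field; rewrite s_neq0 Cn.
move=> /andP[Dn An]; rewrite B0 C0 in hS *; case: hS => [[-> ->] | [-> ->]].
  exists (s * D ^+ 2)^-1; first by rewrite invr_eq0 mulf_neq0 ?sqrf_eq0.
  by split; field; rewrite s_neq0 Dn.
exists (s * A ^+ 2)^-1; first by rewrite invr_eq0 mulf_neq0 ?sqrf_eq0.
by split; field; rewrite s_neq0 An.
Qed.

End JacobiQuarticW.

Theorem proposition4 (F : finFieldType) (eps delta s : F)
  (odd_char : 2%N \notin [pchar F])
  (nonsingular : eps * (delta ^+ 2 - eps) != 0)
  (eps_square : quad_char eps = 1)
  (sqrt_eps : s ^+ 2 = eps) :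
  inverted_montgomery_like (jacobi_quartic eps delta) (jq_w s)
    (2 * (s - delta) / s).
Proof.
have two_neq0 : 2 != 0 :> F by move: odd_char; rewrite inE.
split; [exact: jq_w_ratfun | exact: jq_w_even | move=> P Q hP hQ].
have hA := jq_add_on_curve two_neq0 nonsingular.
have hO := jq_opp_on_curve _ eps delta.
have val R := jq_w_value _ eps delta s sqrt_eps nonsingular R.
have [c0 c0n ->] := val _ (hA _ _ hQ (hO _ hP)).
have [c1 c1n ->] := val _ hP.
have [c2 c2n ->] := val _ hQ.
have [c3 c3n ->] := val _ (hA _ _ hP hQ).
have [c4 c4n ->] := val _ (hA _ _ hP hP).
have [dT dZ] := jq_w_double _ eps delta s two_neq0 sqrt_eps nonsingular _ hP.
have addE := jq_w_add _ eps delta s sqrt_eps nonsingular _ _ hP hQ.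
rewrite /= !mulf_eq0 !negb_or -!andbA => /and4P[_ _ Tn /andP[_ Zn]].
have [c cn [sT sZ]] := addE (mulf_neq0 Tn Zn).
split.
  (* The right-hand sides are forms: of degree 4 in (W1 : Z1) here, and of
     degrees 1, 2, 2 in the three arguments below. *)
  exists (c4 / c1 ^+ 4); first by rewrite mulf_neq0 ?invr_eq0 ?expf_neq0.
  move: (2 * (s - delta) / s) dT => e dT.
  by rewrite dT dZ; congr pair => /=; field.
exists (c3 * c / (c0 * c1 ^+ 2 * c2 ^+ 2)).
  by rewrite !(mulf_neq0, invr_eq0, expf_neq0).
by rewrite sT sZ; congr pair => /=; field; rewrite c0n c1n c2n.
Qed.
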